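(* Let $n > k \ge 2$ be integers with $k$ known to the algorithm. The minimum number of queries that a non-adaptive algorithm must make to an error-free same-cluster oracle in order to learn every partition of $V=[n]$ into exactly $k$ nonempty clusters is: (i) $n-1$ if $k=2$; (ii) $5$ if $k=3$ and $n=4$; (iii) $\binom{n}{2} - \lfloor n/2 \rfloor$ if $k=3$ and $n\ge 5$; (iv) $\binom{n}{2}-1$ if $k\ge 4$.
   Context: Given a partition $\mathcal{C}$ of a finite set $V$, the (error-free) same-cluster oracle takes a pair $\{u,v\}$ of distinct elements of $V$ and answers whether $u$ and $v$ lie in the same cluster of $\mathcal{C}$. A non-adaptive algorithm submits all its queries in a single round (chosen before seeing any answers) and then must determine $\mathcal{C}$ exactly from the answers, for every partition $\mathcal{C}$ of $V$ into exactly $k$ nonempty clusters. *)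

(* Defs.v *)
From mathcomp Require Import all_boot.

Set Implicit Arguments.
Unset Strict Implicit.
Unset Printing Implicit Defensive.

(* MathComp's [partition] already requires every block to be nonempty. *)
Definition clustering (n k : nat) (C : {set {set 'I_n}}) : bool :=
  partition C [set: 'I_n] && (#|C| == k).

Definition query (n : nat) : Type := {e : {set 'I_n} | #|e| == 2}.

Definition same_cluster (n : nat) (C : {set {set 'I_n}}) (e : query n) : bool :=
  [exists B in C, val e \subset B].

(* The m queries are fixed in advance; the output depends only on the list of
   the m answers (and on n, k). *)
Record nonadaptive_algorithm (n m : nat) : Type := NonadaptiveAlgorithm {
  queries : m.-tuple (query n);
  output : m.-tuple bool -> {set {set 'I_n}}
}.

Definition run (n m : nat) (A : nonadaptive_algorithm n m)
    (C : {set {set 'I_n}}) : {set {set 'I_n}} :=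
  output A (map_tuple (same_cluster C) (queries A)).

Definition learns (n k m : nat) (A : nonadaptive_algorithm n m) : Prop :=
  forall C : {set {set 'I_n}}, clustering k C -> run A C = C.

Definition min_nonadaptive_queries (n k m : nat) : Prop :=
  (exists A : nonadaptive_algorithm n m, learns k A) /\
  (forall (q : nat) (A : nonadaptive_algorithm n q), learns k A -> m <= q).

(* Main.v *)
Require Import Defs.
From mathcomp Require Import all_boot zify.

(** For k >= 3 two unasked pairs {a,b}, {a,c} cannot be told apart: cluster b with
    a, or c with a, and split the remaining n - 3 points into k - 2 clusters.  So
    the unasked pairs form a matching.  Two disjoint unasked pairs ab, cd are fatal
    when k >= 4 or n = 4: compare {a,b},{c},{d} with {a},{b},{c,d}.  Conversely, if
    the unasked pairs form a matching and two k-clusterings differ on ab, then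
    {a,b} is a cluster of one while {a} and {b} are clusters of the other, so they
    also differ elsewhere, and for k = 3, n >= 5 the other points (at least 3) are
    a single cluster of one clustering and two clusters of the other, which differ
    on two adjacent pairs.  For k = 2 a star suffices, and n - 1 answers are needed
    because there are 2^(n-1) - 1 clusterings. *)

Set Implicit Arguments.
Unset Strict Implicit.
Unset Printing Implicit Defensive.

Section Clusterings.

Variable n : nat.
Implicit Types (C : {set {set 'I_n}}) (x y : 'I_n) (e : query n).

(** * Clusterings through their block functions, and queries as pairs *)

Lemma in_cover_clustering k C x : clustering k C -> x \in cover C.
Proof. by case/andP=> /cover_partition ->; rewrite inE. Qed.

Lemma clustering_trivIset k C : clustering k C -> trivIset C.
Proof. by case/andP=> /partition_trivIset. Qed.

Lemma pblock_sym k C x y :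
  clustering k C -> (y \in pblock C x) = (x \in pblock C y).
Proof.
move=> clC; have tiC := clustering_trivIset clC.
by rewrite -!eq_pblock ?(in_cover_clustering _ clC) 1?eq_sym.
Qed.

(** No block is empty, so comparing clusterings reduces to comparing the functions [pblock C]. *)
Lemma clustering_imset k C : clustering k C -> C = pblock C @: [set: 'I_n].
Proof.
move=> clC; have [partC _] := andP clC; have tiC := partition_trivIset partC.
apply/setP=> B; apply/idP/imsetP => [BC | [x _ ->]]; last first.
  exact: pblock_mem (in_cover_clustering x clC).
have /set0Pn[x Bx] := partition_neq0 partC BC.
by exists x => //; rewrite (def_pblock tiC BC Bx).
Qed.

Lemma eq_clustering k k' C C' : clustering k C -> clustering k' C' ->
  (forall x y, x != y -> (y \in pblock C x) = (y \in pblock C' x)) -> C = C'.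
Proof.
move=> clC clC' eqCC'.
rewrite (clustering_imset clC) (clustering_imset clC').
apply: eq_imset => x; apply/setP=> y.
have [<- | ] := eqVneq x y; last exact: eqCC'.
by rewrite !mem_pblock (in_cover_clustering x clC) (in_cover_clustering x clC').
Qed.

Lemma same_clusterE k C e x y : clustering k C -> val e = [set x; y] ->
  same_cluster C e = (y \in pblock C x).
Proof.
move=> clC ve; have tiC := clustering_trivIset clC.
rewrite /same_cluster ve; apply/exists_inP/idP => [[B BC] | yCx].
  rewrite subUset !sub1set => /andP[xB yB].
  by rewrite (def_pblock tiC BC xB).
exists (pblock C x); first exact: pblock_mem (in_cover_clustering x clC).
by rewrite subUset !sub1set yCx mem_pblock (in_cover_clustering x clC).
Qed.

Lemma queryP e : exists x y, x != y /\ val e = [set x; y].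
Proof. exact/cards2P/(valP e). Qed.

Lemma query_ex x y : x != y -> exists e, val e = [set x; y].
Proof.
move=> neq_xy; have c2 : #|[set x; y]| == 2 by rewrite cards2 neq_xy.
by exists (exist (fun A : {set 'I_n} => #|A| == 2) _ c2).
Qed.

Lemma card_query : #|{: query n}| = 'C(n, 2).
Proof.
rewrite card_sig -[n in RHS]card_ord -card_draws.
by apply: eq_card => A; rewrite !inE.
Qed.

Lemma pblock_preim (rT : eqType) (f : 'I_n -> rT) x y :
  (y \in pblock (preim_partition f [set: 'I_n]) x) = (f x == f y).
Proof.
rewrite pblock_equivalence_partition ?inE //.
by move=> a b c _ _ _; split=> // /eqP->.
Qed.

Lemma preim_clustering k (f : 'I_n -> nat) : (forall x, f x < k) ->
  (forall j, j < k -> exists x, f x = j) ->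
  clustering k (preim_partition f [set: 'I_n]).
Proof.
move=> ltf ontof; rewrite /clustering preim_partitionP /=.
pose F (j : 'I_k) := [set x | f x == j].
(* Every colour is attained, so distinct colours have distinct fibres and the blocks number exactly
   [k]. *)
have injF : injective F.
  move=> i j /setP eqF; have [x fx] := ontof i (ltn_ord i).
  by have := eqF x; rewrite !inE fx eqxx => /esym/eqP/val_inj.
suff -> : preim_partition f [set: 'I_n] = F @: [set: 'I_k].
  by rewrite card_imset // cardsT card_ord.
apply/setP=> B; apply/imsetP/imsetP => [[x _ ->] | [j _ ->]].
  exists (Ordinal (ltf x)) => //.
  by apply/setP=> y; rewrite !inE /= eq_sym.
have [x fx] := ontof j (ltn_ord j).
by exists x => //; apply/setP=> y; rewrite !inE fx eq_sym.
Qed.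

(** * Learning as injectivity of the answer map *)

Lemma learns_inj k m (A : nonadaptive_algorithm n m) C C' :
  learns k A -> clustering k C -> clustering k C' ->
  {in queries A, same_cluster C =1 same_cluster C'} -> C = C'.
Proof.
move=> learnA clC clC' eqCC'.
rewrite -(learnA _ clC) -(learnA _ clC') /run; congr (output A _).
by apply: val_inj => /=; apply/eq_in_map.
Qed.

Lemma resolving_learns k (Q : {set query n}) :
  (forall C C', clustering k C -> clustering k C' ->
     {in Q, same_cluster C =1 same_cluster C'} -> C = C') ->
  exists A : nonadaptive_algorithm n #|Q|, learns k A.
Proof.
move=> resQ; pose t : #|Q|.-tuple (query n) := enum_tuple Q.
(* The decoder picks any clustering consistent with the answers. The default [set0] never arises on
   true answers, since the hidden clustering is itself consistent. *)
pose out (r : #|Q|.-tuple bool) := odflt set0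
  [pick C | clustering k C && (map_tuple (same_cluster C) t == r)].
exists (NonadaptiveAlgorithm t out) => C clC.
rewrite /run /= /out; case: pickP => [C' /andP[clC' /eqP/(congr1 val)/= eqt] | ].
  apply: resQ => // e eQ; move/eq_in_map: eqt; apply.
  by rewrite mem_enum.
by move/(_ C); rewrite clC eqxx.
Qed.


(** * Indistinguishable clusterings for [k >= 3] *)

Lemma uniq_extend (p : seq 'I_n) : uniq p ->
  exists r, uniq (p ++ r) /\ size (p ++ r) = n.
Proof.
move=> up; pose r := [seq x <- enum 'I_n | x \notin p]; exists r.
have us : uniq (p ++ r).
  rewrite cat_uniq up filter_uniq ?enum_uniq // andbT.
  by apply/hasPn => x; rewrite mem_filter => /andP[].
split=> //; rewrite -[RHS]card_ord -(card_uniqP us).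
apply: eq_card => x; rewrite mem_cat mem_filter mem_enum andbT.
by case: (x \in p).
Qed.

Definition onto_below k (phi : nat -> nat) : Prop :=
  (forall i, i < n -> phi i < k) /\
  (forall j, j < k -> exists2 i, i < n & phi i = j).

(* A clustering is given by colouring the position of each point in s, so that the
   exceptional points may be assumed to come first. *)
Lemma learns_colouring_inj k m (A : nonadaptive_algorithm n m) x0
    (s : seq 'I_n) (phi psi : nat -> nat) :
  learns k A -> uniq s -> size s = n ->
  onto_below k phi -> onto_below k psi ->
  (forall i j e, i < j < n -> e \in queries A ->
     val e = [set nth x0 s i; nth x0 s j] ->
     (phi i == phi j) = (psi i == psi j)) ->
  forall i j, i < n -> j < n -> (phi i == phi j) = (psi i == psi j).
Proof.
move=> learnA us szs ontophi ontopsi agree i j ltin ltjn.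
have sfull x : x \in s.
  have eqcard : #|s| = #|'I_n| by rewrite (card_uniqP us) szs card_ord.
  by rewrite (subset_cardP eqcard (subset_predT _)).
have ltind x : index x s < n by rewrite -[ltnRHS]szs index_mem.
pose P (f : nat -> nat) := preim_partition (fun x => f (index x s)) [set: 'I_n].
have clP f : onto_below k f -> clustering k (P f).
  move=> [ltf ontof]; apply: preim_clustering => [x | l ltl]; first exact: ltf.
  have [l' ltl' <-] := ontof l ltl.
  by exists (nth x0 s l'); rewrite index_uniq ?szs.
have eqP : P phi = P psi.
  apply: (learns_inj learnA); try exact: clP.
  move=> e eA; have [x [y [neq_xy ve]]] := queryP e.
  wlog ltxy : x y neq_xy ve / index x s < index y s.
    move=> IH; case: (ltngtP (index x s) (index y s)) => ltxy.
    - exact: IH ltxy.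
    - by apply: IH ltxy; [rewrite eq_sym | rewrite setUC].
    - have := nth_index x0 (sfull x); rewrite ltxy nth_index // => eqyx.
      by rewrite eqyx eqxx in neq_xy.
  rewrite !(same_clusterE (clP _ _) ve) // !pblock_preim.
  by apply: agree eA _; rewrite ?ltxy ?ltind ?nth_index.
have := congr1 (fun C => nth x0 s j \in pblock C (nth x0 s i)) eqP.
by rewrite !pblock_preim !index_uniq ?szs.
Qed.

Lemma missing_adjacent k m (A : nonadaptive_algorithm n m) a b c e1 e2 :
  2 < k < n -> learns k A -> uniq [:: a; b; c] ->
  val e1 = [set a; b] -> val e2 = [set a; c] ->
  e1 \notin queries A -> e2 \notin queries A -> False.
Proof.
move=> /andP[k3 ltkn] learnA uabc ve1 ve2 e1A e2A.
have [r [us szs]] := uniq_extend uabc.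
(* Positions 0, 1, 2 hold [a], [b], [c]. Both colourings give later positions the colours 2, 3, ...,
   and colour [k.-1] absorbs the surplus; [k < n] ensures that it is reached. *)
pose phi i := if i <= 1 then 0 else if i == 2 then 1 else minn i.-1 k.-1.
pose psi (i : nat) := if i == 1 then 1 else if i <= 2 then 0 else minn i.-1 k.-1.
have ontophi : onto_below k phi.
  split=> [i _ | [|[|j]] ltj]; first by rewrite /phi; do !case: ifP; lia.
  - by exists 0; rewrite /phi /=; lia.
  - by exists 2; rewrite /phi /=; lia.
  - by exists j.+3; rewrite /phi /=; lia.
have ontopsi : onto_below k psi.
  split=> [i _ | [|[|j]] ltj]; first by rewrite /psi; do !case: ifP; lia.
  - by exists 0; rewrite /psi /=; lia.
  - by exists 1; rewrite /psi /=; lia.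
  - by exists j.+3; rewrite /psi /=; lia.
(* This equation computes to [true = false]. *)
suff: (phi 0 == phi 1) = (psi 0 == psi 1) by [].
apply: (learns_colouring_inj (x0 := a) learnA us szs ontophi ontopsi); try lia.
move=> i j e ij eA ve.
have Ne v1 : val e <> val v1 \/ v1 \in queries A.
  by have [/val_inj <-|] := eqVneq (val e) (val v1); [right | left; apply/eqP].
case: (Ne e1) => [|H1]; last by rewrite H1 in e1A.
case: (Ne e2) => [|H2]; last by rewrite H2 in e2A.
rewrite ve ve1 ve2 /phi /psi; case: i j ij {ve} => [|[|[|i]]] [|[|[|j]]] //=; lia.
Qed.

Lemma missing_disjoint k m (A : nonadaptive_algorithm n m) a b c d e1 e2 :
  2 < k < n -> (3 < k) || (n == 4) -> learns k A -> uniq [:: a; b; c; d] ->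
  val e1 = [set a; b] -> val e2 = [set c; d] ->
  e1 \notin queries A -> e2 \notin queries A -> False.
Proof.
move=> /andP[k3 ltkn] k4 learnA uabcd ve1 ve2 e1A e2A.
have [r [us szs]] := uniq_extend uabcd.
(* Positions 0 to 3 hold [a], [b], [c], [d]. Later positions must avoid colours 0, 1, 2: for [k > 3]
   they get colours from 3 on, and for [n = 4] there are none. *)
pose phi i := if i <= 1 then 0 else minn i.-1 k.-1.
pose psi (i : nat) := if i <= 1 then i else if i <= 3 then 2 else minn i.-1 k.-1.
have ontophi : onto_below k phi.
  split=> [i _ | [|j] ltj]; first by rewrite /phi; do !case: ifP; lia.
  - by exists 0; rewrite /phi /=; lia.
  - by exists j.+2; rewrite /phi /=; lia.
have ontopsi : onto_below k psi.
  split=> [i _ | [|[|[|j]]] ltj]; first by rewrite /psi; do !case: ifP; lia.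
  - by exists 0; rewrite /psi /=; lia.
  - by exists 1; rewrite /psi /=; lia.
  - by exists 2; rewrite /psi /=; lia.
  - by exists j.+4; rewrite /psi /=; lia.
suff: (phi 0 == phi 1) = (psi 0 == psi 1) by [].
apply: (learns_colouring_inj (x0 := a) learnA us szs ontophi ontopsi); try lia.
move=> i j e ij eA ve.
have Ne v1 : val e <> val v1 \/ v1 \in queries A.
  by have [/val_inj <-|] := eqVneq (val e) (val v1); [right | left; apply/eqP].
case: (Ne e1) => [|H1]; last by rewrite H1 in e1A.
case: (Ne e2) => [|H2]; last by rewrite H2 in e2A.
rewrite ve ve1 ve2 /phi /psi.
case: i j ij {ve} => [|[|[|[|i]]]] [|[|[|[|j]]]] //=; lia.
Qed.


(** * Counting the unasked pairs *)

Lemma query_memP e x : x \in val e -> exists2 y, x != y & val e = [set x; y].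
Proof.
have [u [v [neq_uv ->]]] := queryP e.
rewrite !inE => /orP[] /eqP->; first by exists v.
by exists u; [rewrite eq_sym | rewrite setUC].
Qed.

Definition missing m (A : nonadaptive_algorithm n m) : {set query n} :=
  [set e | e \notin queries A].

(** Only an inequality holds, because the tuple of queries may contain repetitions. *)
Lemma card_missing m (A : nonadaptive_algorithm n m) :
  'C(n, 2) - m <= #|missing A|.
Proof.
have -> : missing A = ~: [set e in queries A] by apply/setP=> e; rewrite !inE.
rewrite leq_subLR -card_query -(cardsC [set e in queries A]) leq_add2r.
by rewrite cardsE -[leqRHS](size_tuple (queries A)) card_size.
Qed.

(** A matching is encoded as [trivIset] of the underlying pairs; two distinct pairs sharing a point
    are excluded by [missing_adjacent]. *)
Lemma missing_trivIset k m (A : nonadaptive_algorithm n m) :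
  2 < k < n -> learns k A -> trivIset (val @: missing A).
Proof.
move=> kn learnA; apply/trivIsetP => _ _ /imsetP[e1 e1M ->] /imsetP[e2 e2M ->].
rewrite !inE in e1M e2M => neq_e; apply/negPn/negP; rewrite -setI_eq0.
case/set0Pn => a /setIP[/query_memP[b neq_ab ve1] /query_memP[c neq_ac ve2]].
apply: (missing_adjacent kn learnA _ ve1 ve2 e1M e2M).
rewrite /= !inE negb_or neq_ab neq_ac !andbT /=.
by apply: contraNneq neq_e => eq_bc; rewrite ve1 ve2 eq_bc.
Qed.

Lemma card_missing_le1 k m (A : nonadaptive_algorithm n m) :
  2 < k < n -> (3 < k) || (n == 4) -> learns k A -> #|missing A| <= 1.
Proof.
move=> kn k4 learnA; rewrite leqNgt; apply/negP.
case/card_gt1P=> e1 [e2 [e1M e2M neq_e]].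
have /trivIsetP/(_ (val e1) (val e2)) := missing_trivIset kn learnA.
rewrite !imset_f // (inj_eq val_inj) neq_e -setI_eq0 => /(_ isT isT isT)/eqP.
rewrite !inE in e1M e2M.
have [a [b [neq_ab ve1]]] := queryP e1; have [c [d [neq_cd ve2]]] := queryP e2.
rewrite ve1 ve2 => /setP dis.
apply: (missing_disjoint kn k4 learnA _ ve1 ve2 e1M e2M).
have := dis a; have := dis b; rewrite /= !inE !eqxx ?orbT /=.
move=> /negbT/norP[bc bd] /negbT/norP[ac ad].
by rewrite !negb_or neq_ab ac ad bc bd neq_cd.
Qed.

Lemma card_matching (M : {set query n}) : trivIset (val @: M) -> #|M| <= n %/ 2.
Proof.
move=> /eqP cardM; rewrite leq_divRL // -[leqRHS](card_ord n).
apply: leq_trans (max_card (cover (val @: M))); rewrite -cardM.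
rewrite big_imset /=; last by move=> ? ? _ _; apply: val_inj.
by rewrite (eq_bigr (fun=> 2)) ?sum_nat_const // => e _; apply/eqP/(valP e).
Qed.

(** * Sufficiency of asking everything outside a matching *)

Lemma matching_exists :
  exists2 M : {set query n}, trivIset (val @: M) & #|M| = n %/ 2.
Proof.
(* The pairs are [{2i, 2i+1}], the fibres of halving; for odd [n] the last point stays unmatched. *)
have exF (i : 'I_(n %/ 2)) : exists e, val e = [set x : 'I_n | x %/ 2 == i].
  have lt1 : i * 2 < n by case: i => i /=; lia.
  have lt2 : (i * 2).+1 < n by case: i lt1 => i /=; lia.
  have [|e ve] := @query_ex (Ordinal lt1) (Ordinal lt2).
    by rewrite -val_eqE /=; lia.
  exists e; rewrite ve; apply/setP=> x; rewrite !inE -!val_eqE /=.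
  by apply/idP/idP; lia.
have [F FE] := fin_all_exists exF.
have disF i j x : x \in val (F i) -> x \in val (F j) -> i = j.
  by rewrite !FE !inE => /eqP xi /eqP xj; apply: val_inj; rewrite /= -xi -xj.
exists (F @: [set: 'I_(n %/ 2)]).
  apply/trivIsetP => _ V /imsetP[_ /imsetP[i _ ->] ->].
  case/imsetP=> _ /imsetP[j _ ->] -> neq; rewrite -setI_eq0.
  apply: contraNT neq => /set0Pn[x /setIP[xi xj]].
  by rewrite (disF _ _ _ xi xj).
rewrite card_imset ?cardsT ?card_ord // => i j eqF.
have [x [y [_ ve]]] := queryP (F i).
by apply: (disF i j x); rewrite -?eqF ve !inE eqxx.
Qed.

(* A third point joined to a or b would, both its queries being asked, be joined
   to both in each clustering. *)
Lemma isolated_pair k k' C C' (N : {set {set 'I_n}}) a b :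
  clustering k C -> clustering k' C' -> trivIset N ->
  (forall x y, x != y -> [set x; y] \notin N ->
     (y \in pblock C x) = (y \in pblock C' x)) ->
  a != b -> b \in pblock C a -> b \notin pblock C' a ->
  [/\ pblock C a = [set a; b], pblock C b = [set a; b],
      pblock C' a = [set a] & pblock C' b = [set b]].
Proof.
move=> clC clC' /trivIsetP tiN agree neq_ab bCa bC'a.
have tiC := clustering_trivIset clC; have tiC' := clustering_trivIset clC'.
have abN : [set a; b] \in N.
  by apply: contraLR bCa => abN; rewrite agree.
(* The pair [{u, c}] meets [{a, b}] without being equal to it, so it cannot also belong to the
   matching [N]. *)
have free u c : u \in [set a; b] -> c \notin [set a; b] ->
    (c \in pblock C u) = (c \in pblock C' u).
  move=> uab cab; apply: agree; first by apply: contraNneq cab => <-.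
  apply/negP => ucN; have neq : [set u; c] != [set a; b].
    by apply: contraNneq cab => <-; rewrite !inE eqxx orbT.
  have := tiN _ _ ucN abN neq; rewrite -setI_eq0 => /eqP/setP/(_ u).
  by rewrite in_setI uab !inE eqxx.
have eqb : pblock C b = pblock C a by apply: same_pblock.
have [aab bab] : a \in [set a; b] /\ b \in [set a; b] by rewrite !inE !eqxx orbT.
have far c : c \notin [set a; b] -> c \notin pblock C a.
  move=> cab; apply: contra bC'a => cCa.
  have cC'a : c \in pblock C' a by rewrite -free.
  have cC'b : c \in pblock C' b by rewrite -free // eqb.
  by rewrite -(same_pblock tiC' cC'a) (pblock_sym _ _ clC').
have aC x : x \in pblock C x by rewrite mem_pblock (in_cover_clustering _ clC).
have aC' x : x \in pblock C' x by rewrite mem_pblock (in_cover_clustering _ clC').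
have Ca : pblock C a = [set a; b].
  apply/setP=> c; apply/idP/idP => [|]; first by apply: contraLR => /far.
  by rewrite !inE => /orP[] /eqP->.
have aC'b : a \notin pblock C' b by rewrite (pblock_sym _ _ clC').
rewrite eqb Ca; split=> //; apply/setP=> c; rewrite inE.
- have [-> | neq_ca] := eqVneq c a; [exact: aC' | ]; have [-> | neq_cb] := eqVneq c b.
    exact: negbTE.
  have cab : c \notin [set a; b] by rewrite !inE negb_or neq_ca.
  by rewrite -free // (negbTE (far c cab)).
- have [-> | neq_cb] := eqVneq c b; [exact: aC' | ]; have [-> | neq_ca] := eqVneq c a.
    exact: negbTE.
  have cab : c \notin [set a; b] by rewrite !inE negb_or neq_ca.
  by rewrite -free // eqb (negbTE (far c cab)).
Qed.

Lemma clustering_split k C a b : clustering k C ->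
  C = pblock C a |: (pblock C b |: pblock C @: ~: [set a; b]).
Proof.
move=> clC; rewrite -!imsetU1 {1}(clustering_imset clC).
suff <- : [set: 'I_n] = a |: (b |: ~: [set a; b]) by [].
by apply/setP=> x; rewrite !inE; case: eqP => //=; case: eqP.
Qed.

Lemma notin_pblock_imset k C (B D : {set 'I_n}) : clustering k C ->
  [disjoint B & D] -> B \notin pblock C @: D.
Proof.
move=> clC; rewrite -setI_eq0 => /eqP/setP dis; apply/imsetP => -[x xD defB].
have := dis x; rewrite in_setI xD defB mem_pblock.
by rewrite (in_cover_clustering _ clC) inE.
Qed.

(** One implication suffices, as the roles of [C] and [C'] can be exchanged. *)
Lemma matching_separates k (M : {set query n}) C C' a b :
  trivIset (val @: M) -> (#|M| <= 1) || ((k == 3) && (4 < n)) ->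
  clustering k C -> clustering k C' ->
  {in ~: M, same_cluster C =1 same_cluster C'} ->
  a != b -> b \in pblock C a -> b \in pblock C' a.
Proof.
move=> tiM hM clC clC' agreeM neq_ab bCa; apply/negPn/negP => bC'a.
have agree x y : x != y -> [set x; y] \notin val @: M ->
    (y \in pblock C x) = (y \in pblock C' x).
  move=> neq_xy xyM; have [e ve] := query_ex neq_xy.
  rewrite -(same_clusterE clC ve) -(same_clusterE clC' ve) agreeM //.
  by rewrite inE; apply: contra xyM => eM; rewrite -ve imset_f.
have [Ca Cb C'a C'b] := isolated_pair clC clC' tiM agree neq_ab bCa bC'a.
set D := ~: [set a; b].
have disD (B : {set 'I_n}) : B \subset [set a; b] -> [disjoint B & D].
  by move=> sB; rewrite disjoints_subset setCK.
(* [{a, b}] is one block of [C] but two of [C'], so outside it [C] has one block more than [C']. *)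
have cardC : k = #|pblock C @: D|.+1.
  case/andP: (clC) => _ /eqP <-; rewrite {1}(clustering_split a b clC) Ca Cb.
  by rewrite setUA setUid cardsU1 (notin_pblock_imset clC) ?disD.
have cardC' : k = #|pblock C' @: D|.+2.
  case/andP: (clC') => _ /eqP <-; rewrite {1}(clustering_split a b clC') C'a C'b.
  rewrite !cardsU1 !inE (notin_pblock_imset clC'); last first.
    by rewrite disD // sub1set !inE eqxx orbT.
  rewrite (inj_eq set1_inj) (negbTE neq_ab) /=.
  by rewrite (notin_pblock_imset clC') ?disD ?sub1set ?inE ?eqxx.
have abM : [set a; b] \in val @: M.
  by apply: contraNT bC'a => abM; rewrite -agree.
case/orP: hM => [/card_le1_eqP M1 | /andP[/eqP k3 n4]].
  (* The only unasked pair is [{a, b}], so both clusterings agree on [D], against the counts. *)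
  suff eqI : pblock C @: D = pblock C' @: D.
    by move: cardC'; rewrite {1}cardC eqI; lia.
  apply: eq_in_imset => x xD; apply/setP=> y.
  have [-> | neq_xy] := eqVneq x y.
    by rewrite !mem_pblock !(in_cover_clustering _ clC, in_cover_clustering _ clC').
  apply: agree => //; apply/negP => /imsetP[e eM ve].
  case/imsetP: abM => e' e'M ve'; rewrite (M1 e' e) // -ve' in ve.
  by move: xD; rewrite inE -ve !inE eqxx.
have D3 : 2 < #|D|.
  by have := cardsC [set a; b]; rewrite cards2 neq_ab card_ord -/D; lia.
(* With [k = 3], [D] meets two blocks of [C] and one of [C']; pairs across the two blocks are then
   all unasked. *)
have /card_gt1P[_ [_ [/imsetP[x xD ->] /imsetP[z zD ->] neq_xz]]] :
  1 < #|pblock C @: D| by lia.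
have one u v : u \in D -> v \in D -> pblock C' u = pblock C' v.
  have /card_le1_eqP H : #|pblock C' @: D| <= 1 by lia.
  by move=> uD vD; apply: H; apply: imset_f.
have crossM u v : u \in D -> v \in D -> pblock C u != pblock C v ->
    [set u; v] \in val @: M.
  move=> uD vD neqC; apply: contraNT neqC => uvM.
  have [-> // | neq_uv] := eqVneq u v.
  rewrite eq_pblock ?(clustering_trivIset clC) ?(in_cover_clustering _ clC) //.
  by rewrite agree // (one u v) // mem_pblock (in_cover_clustering _ clC').
have star u v w : u \in D -> v \in D -> w \in D -> v != w ->
    pblock C u != pblock C v -> pblock C u != pblock C w -> False.
  move=> uD vD wD neq_vw uv uw.
  have neq_uv : u != v by apply: contraNneq uv => ->.
  have /trivIsetP/(_ _ _ (crossM _ _ uD vD uv) (crossM _ _ uD wD uw)) := tiM.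
  have neq : [set u; v] != [set u; w].
    apply/eqP => /setP/(_ v); rewrite !inE eqxx orbT => /esym.
    by rewrite eq_sym (negbTE neq_uv) (negbTE neq_vw).
  by move=> /(_ neq); rewrite -setI_eq0 => /eqP/setP/(_ u); rewrite !inE eqxx.
(* A third point shares a block of [C] with at most one of [x], [z], so the other, or [x] if there
   is no sharing, is the centre of two unasked pairs. *)
have [y] : exists y, y \in D :\: [set x; z].
  apply/set0Pn; rewrite -card_gt0 cardsD subn_gt0; apply: leq_ltn_trans D3.
  apply: leq_trans (subset_leq_card (subsetIr D [set x; z])) _.
  by rewrite cards2; case: (x != z).
rewrite !inE !negb_or => /andP[/andP[neq_yx neq_yz]].
rewrite -negb_or -in_set2 -in_setC -/D => yD.
have [eq_yx | neqC] := eqVneq (pblock C y) (pblock C x).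
  by apply: (star z x y); rewrite // eq_sym ?eq_yx // eq_sym.
by apply: (star x z y); rewrite // eq_sym.
Qed.

Lemma matching_complement_learns k (M : {set query n}) :
  trivIset (val @: M) -> (#|M| <= 1) || ((k == 3) && (4 < n)) ->
  exists A : nonadaptive_algorithm n ('C(n, 2) - #|M|), learns k A.
Proof.
move=> tiM hM.
have -> : 'C(n, 2) - #|M| = #|~: M| by rewrite -card_query -(cardsC M) addKn.
apply: resolving_learns => C C' clC clC' agree.
apply: (eq_clustering clC clC') => x y neq_xy.
apply/idP/idP; apply: (matching_separates tiM hM) => //.
by move=> e eM; rewrite agree.
Qed.

(** * The case of two clusters *)

(** Points outside the cluster of [z] all lie in the one other cluster, so the queries through [z]
    determine everything. *)
Lemma pblock_two_clusters C x y z : clustering 2 C ->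
  (y \in pblock C x) = ((x \in pblock C z) == (y \in pblock C z)).
Proof.
move=> clC; have tiC := clustering_trivIset clC.
rewrite -!eq_pblock ?(in_cover_clustering _ clC) //.
have PC t : pblock C t \in C by apply: pblock_mem (in_cover_clustering t clC).
case/andP: clC => _ /cards2P[U [V [neqUV defC]]].
have {PC} PC t : (pblock C t == U) || (pblock C t == V).
  by have := PC t; rewrite {2}defC !inE.
have neqVU : V != U by rewrite eq_sym.
case/orP: (PC x) => /eqP->; case/orP: (PC y) => /eqP->; case/orP: (PC z) => /eqP->.
all: by rewrite ?eqxx ?(negbTE neqUV) ?(negbTE neqVU).
Qed.

End Clusterings.

Lemma star_learns n :
  exists A : nonadaptive_algorithm n.+1 n, learns 2 A.
Proof.
have exF (i : 'I_n) : exists e : query n.+1, val e = [set ord0; lift ord0 i].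
  exact: query_ex.
have [F FE] := fin_all_exists exF.
have injF : injective F.
  move=> i j /(congr1 val); rewrite !FE => /setP/(_ (lift ord0 i)).
  by rewrite !inE eqxx (inj_eq lift_inj) => /esym/eqP.
suff: exists A : nonadaptive_algorithm n.+1 #|F @: [set: 'I_n]|, learns 2 A.
  by rewrite card_imset // cardsT card_ord.
apply: resolving_learns => C C' clC clC' agree.
apply: (eq_clustering clC clC') => x y _.
rewrite (pblock_two_clusters x y ord0 clC) (pblock_two_clusters x y ord0 clC').
have eq0 t : (t \in pblock C ord0) = (t \in pblock C' ord0).
  case: (unliftP ord0 t) => [i -> | ->]; last first.
    by rewrite !mem_pblock (in_cover_clustering _ clC) (in_cover_clustering _ clC').
  rewrite -(same_clusterE clC (FE i)) -(same_clusterE clC' (FE i)).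
  by apply: agree; rewrite imset_f.
by rewrite !eq0.
Qed.

(* There are 2 ^ n - 1 clusterings of n + 1 points into two clusters, and only
   2 ^ m answer patterns. *)
Lemma two_clusters_lower_bound n m (A : nonadaptive_algorithm n.+1 m) :
  1 < n -> learns 2 A -> n <= m.
Proof.
move=> n2 learnA.
pose P (B : {set 'I_n.+1}) :=
  preim_partition (fun x => (x \in B) : nat) [set: 'I_n.+1].
pose ans B := map_tuple (same_cluster (P B)) (queries A).
(* Complementary sets give the same clustering; taking the side without [ord0] makes [P] injective,
   and removing [set0] keeps both clusters nonempty. *)
pose D := powerset [set~ (ord0 : 'I_n.+1)] :\ set0.
have clP B : B \in D -> clustering 2 (P B).
  rewrite !inE => /andP[/set0Pn[z zB] sB]; apply: preim_clustering => [x|].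
    by case: (x \in B).
  case=> [|[|//]] _; last by exists z; rewrite zB.
  exists ord0; case: (boolP (ord0 \in B)) => // /(subsetP sB).
  by rewrite !inE eqxx.
have injP : {in D &, injective ans}.
  move=> B B' BD B'D eqt.
  have eqP : P B = P B'.
    by rewrite -(learnA _ (clP _ BD)) -(learnA _ (clP _ B'D)) /run -/(ans B) eqt.
  have no0 (E : {set 'I_n.+1}) : E \in D -> ord0 \in E = false.
    rewrite !inE => /andP[_ sE]; apply/negP => /(subsetP sE).
    by rewrite !inE eqxx.
  apply/setP=> x; have := congr1 (fun C => x \in pblock C ord0) eqP.
  by rewrite !pblock_preim !no0 //; case: (x \in B); case: (x \in B').
have := max_card (ans @: D); rewrite (card_in_imset injP) card_tuple card_bool.
have -> : #|D| = (2 ^ n).-1.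
  have := cardsD1 set0 (powerset [set~ (ord0 : 'I_n.+1)]).
  rewrite card_powerset cardsC1 card_ord !inE sub0set => ->.
  by [].
move=> le_pow; rewrite leqNgt; apply/negP => lt_mn.
(* If [m < n], then [2 ^ n - 1 <= 2 ^ n.-1], so [2 ^ n.-1 <= 1], which fails for [n > 1]. *)
have : 2 ^ m <= 2 ^ n.-1 by rewrite leq_pexp2l //; lia.
have : 2 ^ 1 <= 2 ^ n.-1 by rewrite leq_pexp2l //; lia.
have : 2 ^ n = 2 * 2 ^ n.-1 by rewrite -expnS prednK //; lia.
by lia.
Qed.

(** * Assembling the four regimes *)

Theorem theorem5 (n k : nat) (hk : 2 <= k) (hkn : k < n) :
  [/\ k = 2 -> min_nonadaptive_queries n k (n - 1),
      k = 3 -> n = 4 -> min_nonadaptive_queries n k 5,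
      k = 3 -> 5 <= n -> min_nonadaptive_queries n k ('C(n, 2) - n %/ 2)
    & 4 <= k -> min_nonadaptive_queries n k ('C(n, 2) - 1)].
Proof.
(* Cases (ii) and (iv) share this argument, since ['C(4, 2) - 1] is 5. *)
have one_missing : 2 < k -> (3 < k) || (n == 4) ->
    min_nonadaptive_queries n k ('C(n, 2) - 1).
  move=> k3 k4; split=> [|q A learnA]; last first.
    have /(leq_trans (card_missing A)) : #|missing A| <= 1.
      by apply: card_missing_le1 k4 learnA; rewrite k3.
    by rewrite !leq_subLR addnC.
  have lt1n := leq_trans hk (ltnW hkn).
  have [|e _] := @query_ex n (Ordinal (ltnW lt1n)) (Ordinal lt1n); first by [].
  have := @matching_complement_learns n k [set e].
  by rewrite imset_set1 trivIset1 cards1; apply.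
split=> [k2 | k3 n4 | k3 n5 | k4].
- subst k; case: n hkn {one_missing} => // n ltn2; rewrite subn1 /=.
  by split=> [|q A]; [apply: star_learns | apply: two_clusters_lower_bound].
- by have := one_missing; rewrite n4; apply; rewrite ?k3.
- split=> [|q A learnA].
    have [M tiM <-] := matching_exists n.
    by apply: matching_complement_learns => //; rewrite k3 n5 orbT.
  have := leq_trans (card_missing A) (card_matching (missing_trivIset _ learnA)).
  by rewrite k3 /= -{1}k3 hkn => /(_ isT); rewrite !leq_subLR addnC.
- by apply: one_missing; rewrite ?k4 // ltnW.
Qed.
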